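(* Let $G$ be a graph on $t$ vertices, let $s\ge 1$ be an integer with $t>s$, and let $H=\overline{K}_s \vee G$, with $S$ the set of $s$ vertices inducing $\overline{K}_s$. Suppose that one of the following cases holds: (A) $\delta(G)>t-s$; or (B) $\delta(G)=t-s$ and $\overline{G}$ is connected. Then $H$ is $S$-Roth.
   Context: Graphs are finite and simple. $\overline{G}$ is the complement of $G$, $\overline{K}_s$ is the edgeless graph on $s$ vertices, $\delta(G)$ is the minimum degree of $G$, and $G_1\vee G_2$ is the join (disjoint union of $G_1$ and $G_2$ plus all edges between $V(G_1)$ and $V(G_2)$). For a graph $H$ with adjacency matrix $A(H)$ and diagonal degree matrix $D(H)$, the signless Laplacian is $Q(H)=D(H)+A(H)$, and $\mu(H)$ denotes its smallest eigenvalue. Eigenvectors are real. For a vector $x$ indexed by $V(H)$ and nonempty $U\subseteq V(H)$, $x(U)$ is the subvector of entries indexed by $U$; $v>0$ (resp. $v<0$) means all entries of $v$ are strictly positive (resp. negative). Definition: let $H$ be a connected graph and $S\subseteq V(H)$ a maximal (under inclusion) independent set. $H$ is $S$-Roth if for every eigenvector $x$ of $Q(H)$ corresponding to $\mu(H)$, either $x(S)>0$ and $x(V(H)\setminus S)<0$, or $x(S)<0$ and $x(V(H)\setminus S)>0$. *)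

(* Defs.v *)
From HB Require Import structures.
From mathcomp Require Import all_boot all_order all_algebra.
From mathcomp Require Import reals.

Set Implicit Arguments.
Unset Strict Implicit.
Unset Printing Implicit Defensive.

Import Order.TTheory GRing.Theory Num.Theory.
Local Open Scope ring_scope.

(* A graph on n vertices is an adjacency relation e : rel 'I_n which is
   symmetric and irreflexive. *)
Definition simple_graph (n : nat) (e : rel 'I_n) : Prop :=
  symmetric e /\ irreflexive e.

Definition graph_connected (n : nat) (e : rel 'I_n) : Prop :=
  forall u v : 'I_n, connect e u v.

Definition graph_compl (n : nat) (e : rel 'I_n) : rel 'I_n :=
  fun u v => (u != v) && ~~ e u v.

Definition edgeless (n : nat) : rel 'I_n := fun _ _ => false.

(* The m vertices of the first graph come first, via lshift; those of the
   second one follow, via rshift. *)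
Definition graph_join (m n : nat) (e1 : rel 'I_m) (e2 : rel 'I_n) :
    rel 'I_(m + n) :=
  fun u v =>
    match split u, split v with
    | inl u1, inl v1 => e1 u1 v1
    | inr u2, inr v2 => e2 u2 v2
    | _, _ => true
    end.

Definition degree (n : nat) (e : rel 'I_n) (v : 'I_n) : nat :=
  #|[set w | e v w]|.

(* The default value n exceeds every degree of a simple graph, so it does not
   affect the minimum as soon as there is a vertex. *)
Definition min_degree (n : nat) (e : rel 'I_n) : nat :=
  \big[minn/n]_(v < n) degree e v.

Definition independent (n : nat) (e : rel 'I_n) (S : {set 'I_n}) : bool :=
  [forall u in S, forall v in S, ~~ e u v].

Section SignlessLaplacian.
Variables (R : realType) (n : nat).

Definition adjacency_mx (e : rel 'I_n) : 'M[R]_n :=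
  \matrix_(u, v) (e u v)%:R.

Definition degree_mx (e : rel 'I_n) : 'M[R]_n :=
  diag_mx (\row_v (degree e v)%:R).

Definition signless_laplacian (e : rel 'I_n) : 'M[R]_n :=
  degree_mx e + adjacency_mx e.

Definition smallest_eigenvalue (M : 'M[R]_n) (mu : R) : Prop :=
  eigenvalue M mu /\ (forall a : R, eigenvalue M a -> mu <= a).

(* Eigenvectors are row vectors, as for the library's eigenvalue; the signless
   Laplacian of a simple graph is symmetric, so left and right eigenvectors
   coincide. *)
Definition eigenvector (M : 'M[R]_n) (a : R) (x : 'rV[R]_n) : Prop :=
  x != 0 /\ x *m M = a *: x.

Definition positive_on (x : 'rV[R]_n) (U : {set 'I_n}) : Prop :=
  forall v, v \in U -> 0 < x 0 v.

Definition negative_on (x : 'rV[R]_n) (U : {set 'I_n}) : Prop :=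
  forall v, v \in U -> x 0 v < 0.

(* Being S-Roth only makes sense for a connected graph and a maximal
   independent set S, so both requirements are part of the definition. *)
Definition Roth (e : rel 'I_n) (S : {set 'I_n}) : Prop :=
  [/\ graph_connected e,
      maxset (independent e) S
    & forall mu : R, smallest_eigenvalue (signless_laplacian e) mu ->
      forall x : 'rV[R]_n, eigenvector (signless_laplacian e) mu x ->
        (positive_on x S /\ negative_on x (~: S)) \/
        (negative_on x S /\ positive_on x (~: S))].

End SignlessLaplacian.

(* Main.v *)
Require Import Defs.
From HB Require Import structures.
From mathcomp Require Import all_boot all_order all_algebra.
From mathcomp Require Import reals.
From mathcomp Require Import complex spectral.
From mathcomp Require Import ring lra.

Set Implicit Arguments.
Unset Strict Implicit.
Unset Printing Implicit Defensive.

Import Order.TTheory GRing.Theory Num.Theory.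
Local Open Scope ring_scope.

(** Write mu for the least eigenvalue of Q(H), x for an eigenvector, and
    b for the sum of the entries of x over V(G).

    The equation at a vertex of S reads (t - mu) x_i = - b, and mu < t, so x has
    the constant value a = - b / (t - mu) on S.  On V(G), replace the adjacency
    matrix of G by J - I - W, where W is the adjacency matrix of the complement:
    the equations become M z = - (s a + b) 1, with z the restriction of x to
    V(G) and M = diag (d_v + s - 1 - mu) - W.  The off-diagonal entries of M
    are nonpositive, and the quadratic form of Q(H) - mu at a vector that is
    constant (equal to a) on S is
      (t - mu) s a^2 + 2 s a b + b^2 + z^T M z,
    which is nonnegative because mu is the least eigenvalue ([rayleigh_le]).

    If mu > t - s, a Perron argument applies ([least_form_signs]): replacing z
    by - |z| does not increase z^T M z, and for the best value of a the other
    terms add up to - k (sum_v |z_v|)^2 with k > 0, while at x they add up to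
    - k b^2.  Minimality of x therefore forces sum_v |z_v| = |b|, so the entries
    of z have one sign, and the equations make this sign strict and opposite to
    that of a.

    If mu <= t - s, write M = L + diag (2 d_v + s - t - mu) with L the Laplacian
    of the complement.  Both summands are positive semidefinite, as d_v >= t - s,
    while pairing the equations with z gives z^T M z <= 0.  So both forms vanish
    at z.  In case (A) the diagonal is positive, whence z = 0, and then x = 0,
    which is absurd.  In case (B), L z = 0 and the connectedness of the
    complement make z constant, and x is then constant of opposite signs on S
    and on V(G). *)

(** * The variational characterisation of the least eigenvalue *)

(** A unitary change of basis diagonalises the matrix over the complex numbers.
    Its complex eigenvalues are real, hence eigenvalues of the real matrix, and
    both sides become sums weighted by squared norms of coordinates. *)
Lemma rayleigh_le (R : rcfType) (n : nat) (A : 'M[R]_n) (mu : R) :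
    A^T = A -> (forall a, eigenvalue A a -> mu <= a) ->
  forall x : 'rV_n, mu * (\sum_i x 0 i ^+ 2) <= \sum_i (x *m A) 0 i * x 0 i.
Proof.
move=> symA mu_min x.
have -> : \sum_i x 0 i ^+ 2 = (x *m x^T) 0 0.
  by rewrite mxE; apply: eq_bigr => i _; rewrite mxE expr2.
have -> : \sum_i (x *m A) 0 i * x 0 i = (x *m A *m x^T) 0 0.
  by rewrite [RHS]mxE; apply: eq_bigr => i _; rewrite [x^T _ _]mxE.
pose toC : {rmorphism R -> complex R} := real_complex R.
pose B := map_mx toC A; pose P := spectralmx B; pose d := spectral_diag B.
have realC (r : R) : (toC r)^* = toC r.
  by apply/CrealP/complex_realP; exists r.
have realM m p (M : 'M[R]_(m, p)) : map_mx Num.conj (map_mx toC M) = map_mx toC M.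
  by apply/matrixP => i j; rewrite !mxE realC.
have hermB : B \is hermsymmx.
  by apply/is_hermitianmxP; rewrite expr0 scale1r map_trmx symA realM.
have BE : B = invmx P *m diag_mx d *m P.
  exact/orthomx_spectralP/hermitian_normalmx.
have uP : P \in unitmx by exact: spectral_unit.
have le_d i : toC mu <= d 0 i.
  have /mxOverP/(_ 0 i)/complex_realP[k dk] := hermitian_spectral_diag_real hermB.
  rewrite -/d in dk; rewrite dk lecR; apply: mu_min.
  rewrite -(eigenvalue_map toC) -/B; apply/eigenvalueP; exists (row i P).
    rewrite -row_mul BE !mulmxA mulmxV // mul1mx row_mul row_diag_mx -scalemxAl.
    by rewrite -rowE dk.
  apply/negP=> /eqP Pi0.
  have : row i P *m invmx P = 0 by rewrite Pi0 mul0mx.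
  rewrite -row_mul mulmxV // => /rowP/(_ i)/eqP.
  by rewrite !mxE eqxx oner_eq0.
have invP : invmx P = map_mx Num.conj P^T.
  by rewrite invmx_unitary // spectral_unitarymx.
(* The coordinates of x in the basis of eigenvectors. *)
pose X := map_mx toC x; pose y := X *m invmx P.
have yE : map_mx Num.conj y^T = P *m X^T.
  by rewrite /y trmx_mul map_mxM invP trmxCK /X map_trmx realM.
suff: toC (mu * (x *m x^T) 0 0) <= toC ((x *m A *m x^T) 0 0) by rewrite lecR.
rewrite rmorphM.
have -> : toC ((x *m x^T) 0 0) = \sum_i y 0 i * (y 0 i)^*.
  have -> : toC ((x *m x^T) 0 0) = (map_mx toC (x *m x^T)) 0 0 by rewrite [RHS]mxE.
  rewrite map_mxM -map_trmx -/X -{1}(mulmxKV uP X) -(mulmxA _ P) -yE mxE.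
  by apply: eq_bigr => i _; rewrite !mxE.
have -> : toC ((x *m A *m x^T) 0 0) = \sum_i d 0 i * (y 0 i * (y 0 i)^*).
  have -> : toC ((x *m A *m x^T) 0 0) = (map_mx toC (x *m A *m x^T)) 0 0.
    by rewrite [RHS]mxE.
  rewrite !map_mxM -map_trmx -/X -/B BE !mulmxA -/y -(mulmxA _ P) -yE mul_mx_diag mxE.
  by apply: eq_bigr => i _; rewrite !mxE mulrCA mulrA.
rewrite mulr_sumr; apply: ler_sum => i _.
by apply: ler_wpM2r => //; apply: mul_conjC_ge0.
Qed.

(** * Quadratic forms with nonpositive off-diagonal entries *)

Section Energy.
Variables (R : realFieldType) (T : finType) (W : T -> T -> R).
Hypothesis W_ge0 : forall u v, 0 <= W u v.

(** The quadratic form of the matrix diag m - W. *)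
Definition energy (m z : T -> R) : R :=
  \sum_v m v * z v ^+ 2 - \sum_v \sum_u W v u * (z v * z u).

Lemma energyE m z :
  energy m z = \sum_v z v * (m v * z v - \sum_u W v u * z u).
Proof.
rewrite /energy -sumrB; apply: eq_bigr => v _.
rewrite mulrBr mulr_sumr; congr (_ - _); first by ring.
by apply: eq_bigr => u _; ring.
Qed.

(** This is where the sign of the off-diagonal entries - W u v matters. *)
Lemma energy_abs m z : energy m (fun v => `|z v|) <= energy m z.
Proof.
rewrite /energy; apply: lerB.
  by apply: ler_sum => v _; rewrite real_normK ?num_real.
apply: ler_sum => v _; apply: ler_sum => u _.
by rewrite -normrM ler_wpM2l // ler_norm.
Qed.

Hypothesis W_sym : forall u v, W u v = W v u.

(** Subtracting the row sums of W from the diagonal leaves the Laplacian of the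
    weights W, whose form is a sum of squares. *)
Lemma energy_laplacian m z :
  energy m z = \sum_v (m v - \sum_u W v u) * z v ^+ 2
             + 2^-1 * \sum_v \sum_u W v u * (z v - z u) ^+ 2.
Proof.
have eqW : \sum_v \sum_u W v u * z u ^+ 2 = \sum_v (\sum_u W v u) * z v ^+ 2.
  rewrite exchange_big; apply: eq_bigr => v _; rewrite mulr_suml.
  by apply: eq_bigr => u _; rewrite W_sym.
have -> : \sum_v \sum_u W v u * (z v - z u) ^+ 2 =
   \sum_v (\sum_u W v u) * z v ^+ 2 + \sum_v \sum_u W v u * z u ^+ 2
   - 2 * \sum_v \sum_u W v u * (z v * z u).
  rewrite mulr_sumr -big_split -sumrB; apply: eq_bigr => v _ /=.
  rewrite mulr_suml mulr_sumr -big_split -sumrB; apply: eq_bigr => u _ /=.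
  by ring.
rewrite eqW /energy.
have -> : \sum_v (m v - \sum_u W v u) * z v ^+ 2 =
   \sum_v m v * z v ^+ 2 - \sum_v (\sum_u W v u) * z v ^+ 2.
  by rewrite -sumrB; apply: eq_bigr => v _; rewrite mulrBl.
by field.
Qed.

(** A Perron-Frobenius argument: a zero (a, z) of the nonnegative form is compared
    with the vector obtained from - |z| by optimising the other coordinate,
    a' = (\sum_v |z v|) / tau.  Up to the sign of the whole vector, that is the
    pair (- a', |z|) used in the proof. *)
Lemma least_form_signs (m z : T -> R) (s tau a : R) :
    0 < tau -> tau < s ->
    (forall a' z', 0 <= tau * s * a' ^+ 2 + 2 * s * a' * (\sum_v z' v)
                        + (\sum_v z' v) ^+ 2 + energy m z') ->
    tau * a = - \sum_v z v ->
    (forall v, m v * z v - \sum_u W v u * z u = - (s * a + \sum_v z v)) ->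
    (exists v, z v != 0) -> 0 <= \sum_v z v ->
  a < 0 /\ forall v, 0 < z v.
Proof.
move=> tau_gt0 tau_lt psd eq_a eq_z nz b_ge0.
set b := \sum_v z v in eq_a eq_z b_ge0 *.
pose k := s / tau - 1.
have aE : a = - b / tau by rewrite -eq_a mulrC mulKf ?gt_eqF.
have k_gt0 : 0 < k by rewrite subr_gt0 ltr_pdivlMr // mul1r.
have eq_zk v : m v * z v - \sum_u W v u * z u = k * b.
  by rewrite eq_z aE /k; field; rewrite gt_eqF.
have Ez : energy m z = k * b ^+ 2.
  rewrite energyE (eq_bigr (fun v => z v * (k * b))); last by move=> v _; rewrite eq_zk.
  by rewrite -mulr_suml -/b; ring.
(* Comparing the two vectors shows that z cannot have cancellations. *)
pose p := \sum_v `|z v|.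
have le_pb : p <= b.
  have := psd (- p / tau) (fun v => `|z v|); rewrite -/p => psd_p.
  have := energy_abs m z; rewrite Ez => le_E.
  have : k * p ^+ 2 <= k * b ^+ 2.
    apply: le_trans le_E; rewrite -subr_ge0; move: psd_p; congr (_ <= _).
    by rewrite /k; field; rewrite gt_eqF.
  rewrite ler_pM2l // ler_pXn2r // nnegrE; exact: sumr_ge0.
have z_ge0 v : 0 <= z v.
  have : \sum_v (`|z v| - z v) == 0.
    rewrite eq_le sumr_ge0 ?andbT; last by move=> u _; rewrite subr_ge0 ler_norm.
    by rewrite sumrB subr_le0.
  rewrite psumr_eq0; last by move=> u _; rewrite subr_ge0 ler_norm.
  by move=> /allP/(_ v (mem_index_enum _)); rewrite subr_eq0 => /eqP <-.
have b_gt0 : 0 < b.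
  rewrite lt_def b_ge0 andbT; case: nz => v; apply: contraNneq => b0.
  have /eqP := b0; rewrite /b psumr_eq0; last by move=> u _; exact: z_ge0.
  by move=> /allP/(_ v (mem_index_enum _)).
split; first by rewrite aE mulNr oppr_lt0 divr_gt0.
(* At a zero of z, the equation equates k * b > 0 with a nonpositive sum. *)
move=> v; rewrite lt_def z_ge0 andbT; apply/negP => /eqP zv0.
have := eq_zk v; rewrite zv0 mulr0 sub0r => /esym eqv.
have : 0 < k * b by rewrite mulr_gt0.
rewrite eqv oppr_gt0 ltNge sumr_ge0 // => u _; exact: mulr_ge0.
Qed.

End Energy.

(** * Degrees, complements and joins *)

Lemma graph_join_ll m n (e1 : rel 'I_m) (e2 : rel 'I_n) i j :
  graph_join e1 e2 (lshift n i) (lshift n j) = e1 i j.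
Proof. by rewrite /graph_join (unsplitK (inl i)) (unsplitK (inl j)). Qed.

Lemma graph_join_lr m n (e1 : rel 'I_m) (e2 : rel 'I_n) i j :
  graph_join e1 e2 (lshift n i) (rshift m j).
Proof. by rewrite /graph_join (unsplitK (inl i)) (unsplitK (inr j)). Qed.

Lemma graph_join_rl m n (e1 : rel 'I_m) (e2 : rel 'I_n) i j :
  graph_join e1 e2 (rshift m j) (lshift n i).
Proof. by rewrite /graph_join (unsplitK (inl i)) (unsplitK (inr j)). Qed.

Lemma graph_join_rr m n (e1 : rel 'I_m) (e2 : rel 'I_n) i j :
  graph_join e1 e2 (rshift m i) (rshift m j) = e2 i j.
Proof. by rewrite /graph_join (unsplitK (inr i)) (unsplitK (inr j)). Qed.

Lemma degreeE n (e : rel 'I_n) v : degree e v = (\sum_u e v u)%N.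
Proof. by rewrite /degree cardsE -sum1_card big_mkcond. Qed.

Lemma degree_compl n (e : rel 'I_n) v : irreflexive e ->
  (degree e v + degree (graph_compl e) v).+1 = n.
Proof.
move=> e_irr; rewrite !degreeE -big_split /=.
rewrite -[RHS]card_ord -sum1_card (bigD1 v) //= [in RHS](bigD1 v) //=.
rewrite /graph_compl e_irr eqxx /= add0n -add1n; congr addn.
by apply: eq_bigr => u; rewrite eq_sym => ->; case: (e v u).
Qed.

Lemma min_degree_le n (e : rel 'I_n) v : (min_degree e <= degree e v)%N.
Proof. by rewrite -leEnat /min_degree -minEnat bigmin_le. Qed.

Lemma mulmx_signless (R : realType) n (e : rel 'I_n) (x : 'rV[R]_n) v :
    symmetric e ->
  (x *m signless_laplacian R e) 0 v
    = (degree e v)%:R * x 0 v + \sum_u (e v u)%:R * x 0 u.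
Proof.
move=> e_sym; rewrite mulmxDr mul_mx_diag !mxE mulrC; congr (_ + _).
by apply: eq_bigr => u _; rewrite !mxE e_sym mulrC.
Qed.

Lemma signless_laplacian_sym (R : realType) n (e : rel 'I_n) :
  symmetric e -> (signless_laplacian R e)^T = signless_laplacian R e.
Proof.
move=> e_sym; rewrite /signless_laplacian linearD /= tr_diag_mx; congr (_ + _).
by apply/matrixP => u v; rewrite !mxE e_sym.
Qed.

Lemma sum_compl (R : realType) n (e : rel 'I_n) (z : 'I_n -> R) v :
    irreflexive e ->
  \sum_u (e v u)%:R * z u
    = \sum_u z u - z v - \sum_u (graph_compl e v u)%:R * z u.
Proof.
move=> e_irr.
suff -> : \sum_u z u = \sum_u (e v u)%:R * z u + z v
                      + \sum_u (graph_compl e v u)%:R * z u by ring.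
have -> : z v = \sum_u (u == v)%:R * z u.
  rewrite (bigD1 v) //= eqxx mul1r big1 ?addr0 // => u /negPf->.
  by rewrite mul0r.
rewrite -!big_split; apply: eq_bigr => u _ /=.
rewrite /graph_compl eq_sym; have [->|_] := eqVneq u v.
  by rewrite e_irr /=; ring.
by case: (e v u) => /=; ring.
Qed.

Lemma join_connected m n (e1 : rel 'I_m) (e2 : rel 'I_n) :
  (0 < m)%N -> (0 < n)%N -> graph_connected (graph_join e1 e2).
Proof.
move=> m_gt0 n_gt0 u v.
pose i0 := Ordinal m_gt0; pose j0 := Ordinal n_gt0.
have lr i j : connect (graph_join e1 e2) (lshift n i) (rshift m j).
  by apply: connect1; exact: graph_join_lr.
have rl i j : connect (graph_join e1 e2) (rshift m j) (lshift n i).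
  by apply: connect1; exact: graph_join_rl.
case: (split_ordP u) => i ->; case: (split_ordP v) => j -> //.
  exact: connect_trans (lr i j0) (rl j j0).
exact: connect_trans (rl i0 i) (lr i0 j).
Qed.

Lemma join_maxset m n (e2 : rel 'I_n) : (0 < m)%N ->
  maxset (independent (graph_join (@edgeless m) e2))
         [set lshift n i | i in [set: 'I_m]].
Proof.
move=> m_gt0; apply/maxsetP; split.
  apply/forall_inP => _ /imsetP[i _ ->]; apply/forall_inP => _ /imsetP[j _ ->].
  by rewrite graph_join_ll.
move=> B /forall_inP indB sSB; apply/eqP; rewrite eqEsubset sSB andbT.
apply/subsetP => v vB; case: (split_ordP v) => j ev; first by rewrite ev imset_f.
have i0B : lshift n (Ordinal m_gt0) \in B by apply: (subsetP sSB); exact: imset_f.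
have /forall_inP/(_ v vB) := indB _ i0B.
by rewrite ev graph_join_lr.
Qed.

Lemma connected_const (T : finType) (A : Type) (e : rel T) (z : T -> A) :
    (forall u v, connect e u v) -> (forall u v, e u v -> z u = z v) ->
  forall u v, z u = z v.
Proof.
move=> e_conn ez u v; have /connectP[p] := e_conn u v.
elim: p u => [|w p IHp] u /=; first by move=> _ ->.
by case/andP => /ez -> pw lw; exact: IHp.
Qed.

(** * The quadratic form of the join *)

Section Join.
Variables (R : realType) (s t : nat) (G : rel 'I_t).
Hypothesis hG : simple_graph G.

Let G_sym : symmetric G := hG.1.
Let G_irr : irreflexive G := hG.2.

Let H : rel 'I_(s + t) := graph_join (@edgeless s) G.
Let Q : 'M[R]_(s + t) := signless_laplacian R H.
Let W (v u : 'I_t) : R := (graph_compl G v u)%:R.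

Lemma join_sym : symmetric H.
Proof.
move=> u v; case: (split_ordP u) => i ->; case: (split_ordP v) => j ->;
by rewrite /H ?graph_join_ll ?graph_join_lr ?graph_join_rl ?graph_join_rr.
Qed.

Lemma degree_join_l i : degree H (lshift t i) = t.
Proof.
rewrite degreeE big_split_ord /= big1 => [|j _]; last by rewrite /H graph_join_ll.
rewrite (eq_bigr (fun=> 1%N)) => [|j _]; last by rewrite /H graph_join_lr.
by rewrite sum1_card card_ord.
Qed.

Lemma degree_join_r j : degree H (rshift s j) = (s + degree G j)%N.
Proof.
rewrite !degreeE big_split_ord /=; congr addn.
  rewrite (eq_bigr (fun=> 1%N)) => [|i _]; last by rewrite /H graph_join_rl.
  by rewrite sum1_card card_ord.
by apply: eq_bigr => u _; rewrite /H graph_join_rr.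
Qed.

Lemma mulmx_join_l (x : 'rV_(s + t)) i :
  (x *m Q) 0 (lshift t i) = t%:R * x 0 (lshift t i) + \sum_v x 0 (rshift s v).
Proof.
rewrite mulmx_signless; last exact: join_sym.
rewrite degree_join_l big_split_ord /= big1 ?add0r => [|j _]; last first.
  by rewrite /H graph_join_ll mul0r.
by congr (_ + _); apply: eq_bigr => j _; rewrite /H graph_join_lr mul1r.
Qed.

(** The - 1 comes from writing the adjacency matrix of G as J - I - W, with W the
    adjacency matrix of the complement. *)
Definition join_diag (mu : R) (v : 'I_t) : R := (degree G v)%:R + s%:R - 1 - mu.

(** The sum over the neighbours in G is traded for the sum over all of V(G),
    which joins the contribution of the independent part, and a sum over
    the complement, which enters with a minus sign. *)
Lemma mulmx_join_r mu (x : 'rV_(s + t)) v :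
  (x *m Q) 0 (rshift s v) - mu * x 0 (rshift s v) =
    join_diag mu v * x 0 (rshift s v) - \sum_u W v u * x 0 (rshift s u)
    + (\sum_i x 0 (lshift t i) + \sum_u x 0 (rshift s u)).
Proof.
rewrite mulmx_signless; last exact: join_sym.
rewrite degree_join_r big_split_ord /=.
rewrite (eq_bigr (fun i => x 0 (lshift t i))) => [|i _]; last first.
  by rewrite /H graph_join_rl mul1r.
under [X in _ + (_ + X)]eq_bigr do rewrite /H graph_join_rr.
rewrite (sum_compl (fun u => x 0 (rshift s u))) // natrD /join_diag /W.
by ring.
Qed.

Lemma join_form_ge0 mu a (z : 'I_t -> R) :
    (forall r, eigenvalue Q r -> mu <= r) ->
  0 <= (t%:R - mu) * s%:R * a ^+ 2 + 2 * s%:R * a * (\sum_v z v)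
       + (\sum_v z v) ^+ 2 + energy W (join_diag mu) z.
Proof.
move=> mu_min.
pose x : 'rV[R]_(s + t) := row_mx (const_mx a) (\row_v z v).
have xl i : x 0 (lshift t i) = a by rewrite row_mxEl mxE.
have xr v : x 0 (rshift s v) = z v by rewrite row_mxEr mxE.
have sum_xr : \sum_v x 0 (rshift s v) = \sum_v z v.
  by apply: eq_bigr => v _; rewrite xr.
have sum_xl : \sum_i x 0 (lshift t i) = s%:R * a.
  by rewrite (eq_bigr (fun=> a)) // sumr_const card_ord mulr_natl.
have := rayleigh_le (signless_laplacian_sym R join_sym) mu_min x.
rewrite -subr_ge0; congr (_ <= _).
have El i : (x *m Q) 0 (lshift t i) * x 0 (lshift t i)
              - mu * x 0 (lshift t i) ^+ 2
            = (t%:R - mu) * a ^+ 2 + a * \sum_v z v.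
  by rewrite mulmx_join_l xl sum_xr; ring.
have Er v : (x *m Q) 0 (rshift s v) * x 0 (rshift s v)
              - mu * x 0 (rshift s v) ^+ 2
            = z v * (join_diag mu v * z v - \sum_u W v u * z u)
              + z v * (s%:R * a + \sum_v z v).
  rewrite expr2 mulrA -mulrBl mulmx_join_r xr sum_xl sum_xr.
  by under [\sum_u W v u * x _ _]eq_bigr do rewrite xr; ring.
rewrite mulr_sumr -sumrB big_split_ord /=.
rewrite (eq_bigr _ (fun i _ => El i)) (eq_bigr _ (fun v _ => Er v)).
by rewrite sumr_const card_ord big_split /= -mulr_suml -energyE; ring.
Qed.

End Join.

(** * Eigenvectors of the least eigenvalue of the join *)

Section JoinEigen.
Variables (R : realType) (s t : nat) (G : rel 'I_t).
Hypotheses (hG : simple_graph G) (s_gt0 : (0 < s)%N) (t_gt0 : (0 < t)%N).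

Let H : rel 'I_(s + t) := graph_join (@edgeless s) G.
Let Q : 'M[R]_(s + t) := signless_laplacian R H.
Let W (v u : 'I_t) : R := (graph_compl G v u)%:R.

Variables (mu : R) (x : 'rV[R]_(s + t)).
Hypotheses (mu_min : forall r, eigenvalue Q r -> mu <= r).
Hypotheses (x_neq0 : x != 0) (xQ : x *m Q = mu *: x).

Let z (v : 'I_t) : R := x 0 (rshift s v).
Let b : R := \sum_v z v.
Let a : R := - b / (t%:R - mu).

(** If mu >= t, the form at (a, 1) is bounded above by an affine function of a
    with positive slope, hence negative for a sufficiently negative a. *)
Lemma least_eigenvalue_lt : mu < t%:R.
Proof.
rewrite ltNge; apply/negP => le_t_mu.
pose E := energy W (join_diag s G mu) (fun=> 1).
have s0 : 0 < s%:R :> R by rewrite ltr0n.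
have t0 : 0 < t%:R :> R by rewrite ltr0n.
pose k : R := - (t%:R ^+ 2 + `|E| + 1) / (2 * s%:R * t%:R).
have := join_form_ge0 hG k (fun=> 1) mu_min; rewrite -/W -/E.
rewrite sumr_const card_ord -/(t%:R).
have -> : 2 * s%:R * k * t%:R = - (t%:R ^+ 2 + `|E| + 1).
  by rewrite /k; field; rewrite !gt_eqF.
have : (t%:R - mu) * s%:R * k ^+ 2 <= 0.
  by rewrite -mulrA mulr_le0_ge0 ?subr_le0 // mulr_ge0 ?sqr_ge0 ?ltW.
have := ler_norm E; lra.
Qed.

Let tau_gt0 : 0 < t%:R - mu. Proof. by rewrite subr_gt0 least_eigenvalue_lt. Qed.

Lemma eigen_l i : x 0 (lshift t i) = a.
Proof.
have := mulmx_join_l hG x i; rewrite -/H -/Q xQ mxE -/b => eqi.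
have tau_neq0 : t%:R - mu != 0 by rewrite gt_eqF.
apply: (mulfI tau_neq0); rewrite /a mulrCA divff // mulr1 mulrBl eqi.
by ring.
Qed.

Lemma eigen_r v :
  join_diag s G mu v * z v - \sum_u W v u * z u = - (s%:R * a + b).
Proof.
have := mulmx_join_r hG mu x v; rewrite -/H -/Q xQ mxE subrr => /esym/eqP.
rewrite addr_eq0 => /eqP ->; congr (- (_ + _)).
by rewrite (eq_bigr _ (fun i _ => eigen_l i)) sumr_const card_ord mulr_natl.
Qed.

Lemma eigen_r_neq0 : exists v, z v != 0.
Proof.
apply/existsP; apply: contraNT x_neq0; rewrite negb_exists => /forallP z0.
have {}z0 v : z v = 0 by apply/eqP; rewrite -[_ == _]negbK z0.
apply/eqP/rowP => u; rewrite [RHS]mxE.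
case: (split_ordP u) => i ->; last exact: z0.
by rewrite eigen_l /a /b big1 ?oppr0 ?mul0r.
Qed.

Lemma join_diag_compl v :
  join_diag s G mu v - \sum_u W v u = 2 * (degree G v)%:R + s%:R - t%:R - mu.
Proof.
have -> : \sum_u W v u = (degree (graph_compl G) v)%:R.
  by rewrite degreeE natr_sum.
have /(congr1 (GRing.natmul (1 : R))) := degree_compl v hG.2.
by rewrite /join_diag -addn1 !natrD => <-; ring.
Qed.

(** The form of M at z, computed from the equations on the right and through
    the Laplacian of the complement on the left. *)
Lemma eigen_laplacian :
  \sum_v (2 * (degree G v)%:R + s%:R - t%:R - mu) * z v ^+ 2
    + 2^-1 * \sum_v \sum_u W v u * (z v - z u) ^+ 2
  = b ^+ 2 * (s%:R - (t%:R - mu)) / (t%:R - mu).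
Proof.
have W_sym u v : W u v = W v u by rewrite /W /graph_compl hG.1 eq_sym.
have <- : energy W (join_diag s G mu) z = b ^+ 2 * (s%:R - (t%:R - mu)) / (t%:R - mu).
  rewrite energyE (eq_bigr _ (fun v _ => congr1 _ (eigen_r v))) -mulr_suml -/b /a.
  by field; rewrite gt_eqF.
rewrite (energy_laplacian W_sym); congr (_ + _).
by apply: eq_bigr => v _; rewrite join_diag_compl.
Qed.

Lemma eigen_signs_large : t%:R - mu < s%:R ->
  (a < 0 /\ forall v, 0 < z v) \/ (0 < a /\ forall v, z v < 0).
Proof.
move=> tau_lt; have W_ge0 v u : 0 <= W v u by rewrite ler0n.
have eq_a : (t%:R - mu) * a = - b by rewrite /a mulrC divfK // gt_eqF.
have psd a' z' := join_form_ge0 hG a' z' mu_min.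
have [b_ge0|b_lt0] := leP 0 b.
  by left; apply: (least_form_signs W_ge0 tau_gt0 tau_lt psd eq_a eigen_r eigen_r_neq0).
(* Otherwise the previous case applies to the opposite vector. *)
right.
have eqN : \sum_v - z v = - b by rewrite sumrN.
have := @least_form_signs R _ W W_ge0 (join_diag s G mu) (fun v => - z v) s%:R _ (- a)
  tau_gt0 tau_lt psd.
rewrite eqN mulrN eq_a => /(_ erefl); case.
- move=> v; have := eigen_r v.
  by under [in X in _ -> X]eq_bigr do rewrite mulrN; rewrite sumrN; lra.
- by have [v zv] := eigen_r_neq0; exists v; rewrite oppr_eq0.
- by rewrite oppr_ge0 ltW.
by rewrite oppr_lt0 => ? zN; split=> // v; rewrite -oppr_gt0.
Qed.

(** Here both terms on the left of [eigen_laplacian] are nonnegative and its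
    right-hand side is nonpositive. *)
Lemma eigen_zero : (forall v, t%:R - s%:R <= (degree G v)%:R :> R) ->
    s%:R <= t%:R - mu ->
  forall v, (2 * (degree G v)%:R + s%:R - t%:R - mu) * z v ^+ 2 = 0
     /\ forall u, W v u * (z v - z u) ^+ 2 = 0.
Proof.
move=> deg_ge tau_ge.
have diag_ge0 v : 0 <= (2 * (degree G v)%:R + s%:R - t%:R - mu) * z v ^+ 2.
  by rewrite mulr_ge0 ?sqr_ge0 //; have := deg_ge v; lra.
have W_ge0 v u : 0 <= W v u * (z v - z u) ^+ 2 by rewrite mulr_ge0 ?ler0n ?sqr_ge0.
have rhs_le0 : b ^+ 2 * (s%:R - (t%:R - mu)) / (t%:R - mu) <= 0.
  by rewrite pmulr_lle0 ?invr_gt0 // mulr_ge0_le0 ?sqr_ge0 ?subr_le0.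
have WW_ge0 : 0 <= \sum_v \sum_u W v u * (z v - z u) ^+ 2.
  by apply: sumr_ge0 => v _; apply: sumr_ge0 => u _.
have DD_ge0 : 0 <= \sum_v (2 * (degree G v)%:R + s%:R - t%:R - mu) * z v ^+ 2.
  by apply: sumr_ge0.
have eqL := eigen_laplacian.
move=> v; split.
  have /eqP : \sum_v (2 * (degree G v)%:R + s%:R - t%:R - mu) * z v ^+ 2 = 0 by lra.
  by rewrite psumr_eq0 // => /allP/(_ v (mem_index_enum _))/eqP.
move=> u.
have /eqP : \sum_v \sum_u W v u * (z v - z u) ^+ 2 = 0 by lra.
rewrite psumr_eq0; last by move=> w _; apply: sumr_ge0.
move=> /allP/(_ v (mem_index_enum _)); rewrite /= psumr_eq0 //.
by move=> /allP/(_ u (mem_index_enum _))/eqP.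
Qed.

End JoinEigen.

(** The case mu > t - s is [eigen_signs_large]; the other one is the discussion
    of the vanishing forms of [eigen_zero]. *)
Lemma join_eigen_signs (R : realType) (t s : nat) (G : rel 'I_t) (mu : R)
    (x : 'rV[R]_(s + t)) (Q := signless_laplacian R (graph_join (@edgeless s) G))
    (a := - (\sum_v x 0 (rshift s v)) / (t%:R - mu)) :
    simple_graph G -> (0 < s < t)%N ->
    (t - s < min_degree G)%N \/
      (min_degree G = t - s)%N /\ graph_connected (graph_compl G) ->
    (forall r, eigenvalue Q r -> mu <= r) -> x != 0 -> x *m Q = mu *: x ->
  (a < 0 /\ forall v, 0 < x 0 (rshift s v)) \/
  (0 < a /\ forall v, x 0 (rshift s v) < 0).
Proof.
move=> hG /andP[hs hst] hcase mu_min x_neq0 xQ.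
have t_gt0 : (0 < t)%N by exact: leq_ltn_trans hst.
have natB : (t - s)%:R = t%:R - s%:R :> R by rewrite natrB // ltnW.
have [tau_lt|tau_ge] := ltP (t%:R - mu) s%:R.
  exact: (eigen_signs_large hG hs t_gt0 mu_min x_neq0 xQ).
have deg_ge v : t%:R - s%:R <= (degree G v)%:R :> R.
  rewrite -natB ler_nat; apply: leq_trans (min_degree_le G v).
  by case: hcase => [/ltnW //|[-> _]].
have Ez := eigen_zero hG hs t_gt0 mu_min xQ deg_ge tau_ge.
have [v0 xv0] := eigen_r_neq0 hG hs t_gt0 mu_min x_neq0 xQ.
have diag0 : 2 * (degree G v0)%:R + s%:R - t%:R - mu = 0.
  have [/eqP] := Ez v0; rewrite mulf_eq0 sqrf_eq0 (negPf xv0) orbF.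
  by move=> /eqP.
case: hcase => [lt_min|[_ compl_conn]].
  have : t%:R - s%:R < (degree G v0)%:R :> R.
    by rewrite -natB ltr_nat (leq_trans lt_min) ?min_degree_le.
  by lra.
have x_const v : x 0 (rshift s v) = x 0 (rshift s v0).
  apply: (connected_const (z := fun v => x 0 (rshift s v)) compl_conn).
  move=> u w uw; have [_ /(_ w)/eqP] := Ez u.
  by rewrite uw mul1r sqrf_eq0 subr_eq0 => /eqP.
have tau_gt0 : 0 < t%:R - mu by rewrite subr_gt0 (least_eigenvalue_lt hG hs t_gt0 mu_min).
have aE : a = - (t%:R / (t%:R - mu) * x 0 (rshift s v0)).
  rewrite /a (eq_bigr _ (fun v _ => x_const v)) sumr_const card_ord -mulr_natl.
  by ring.
have c_gt0 : 0 < t%:R / (t%:R - mu) by rewrite divr_gt0 ?ltr0n.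
have [x_neg|x_pos|x0] := ltgtP (x 0 (rshift s v0)) 0.
- by right; split=> [|v]; rewrite ?x_const // aE oppr_gt0 pmulr_rlt0.
- by left; split=> [|v]; rewrite ?x_const // aE oppr_lt0 pmulr_rgt0.
- by rewrite x0 eqxx in xv0.
Qed.

Local Close Scope ring_scope.

Theorem theorem9p4 (R : realType) (t s : nat) (G : rel 'I_t)
    (hG : simple_graph G) (hs : 1 <= s) (hst : s < t)
    (hcase : t - s < min_degree G \/
             (min_degree G = t - s /\ graph_connected (graph_compl G))) :
  Roth R (graph_join (@edgeless s) G) [set lshift t i | i in [set: 'I_s]].
Proof.
have t_gt0 : 0 < t by exact: leq_ltn_trans hst.
split; [exact: join_connected | exact: join_maxset |].
move=> mu [_ mu_min] x [x_neq0 xQ].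
have xl := eigen_l hG hs t_gt0 mu_min xQ.
have hst0 : 0 < s < t by rewrite hs.
have [] := join_eigen_signs hG hst0 hcase mu_min x_neq0 xQ; case=> a_sgn r_sgn.
  right; split=> v; first by case/imsetP => i _ ->; rewrite xl.
  by case: (split_ordP v) => i -> //; rewrite inE imset_f.
left; split=> v; first by case/imsetP => i _ ->; rewrite xl.
by case: (split_ordP v) => i -> //; rewrite inE imset_f.
Qed.
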